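(* Let $\mathcal{X}\subseteq\mathbb{R}^n$, let $f:\mathcal{X}\to[0,1]$ be a differentiable function, let $t\in[0,1)$ be a decision threshold, and let $h:\mathcal{X}\to\{0,1\}$ be the classifier with $h(u)=1$ if $f(u)>t$ and $h(u)=0$ otherwise. Let $x\in\mathcal{X}$ with $h(x)=0$, let $\breve{x}\in\mathcal{X}$ be a counterfactual for $x$ (so $h(\breve{x})\neq h(x)$), and let $p_\varepsilon$ be a probability distribution on $\mathbb{R}^n$ (the noise distribution) such that $\breve{x}+\varepsilon\in\mathcal{X}$ almost surely for $\varepsilon\sim p_\varepsilon$. Let $K\ge 1$ be an integer, let $\varepsilon_1,\dots,\varepsilon_K$ be independent random variables each with distribution $p_\varepsilon$, and let $m>0$ be a real number. Then $$\mathbb{P}\left(\Gamma(\breve{x};p_\varepsilon)\le\frac{m+\tilde{\Theta}(\breve{x};K,p_\varepsilon)}{1-t}\right)\ge 1-\exp\left(-2m^2K\right),$$ where $\Gamma$ is the recourse invalidation rate, $\tilde{\Theta}$ is the Monte-Carlo estimator of the soft recourse invalidation rate computed from $\varepsilon_1,\dots,\varepsilon_K$, and the probability is over the draw of $\varepsilon_1,\dots,\varepsilon_K$.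
   Context: The function $f$ is a probabilistic binary classifier: $f(u)$ is the predicted probability of class $1$ at $u$, and $h$ is the class obtained by thresholding $f$ at $t$. A counterfactual for an example $x\in\mathcal{X}$ is a point $\breve{x}\in\mathcal{X}$ with $h(\breve{x})\neq h(x)$. Recourse invalidation rate: for a counterfactual $\breve{x}$ of an example $x$ predicted as class $0$, and $\varepsilon$ an $\mathbb{R}^n$-valued random variable with distribution $p_\varepsilon$, $$\Gamma(\breve{x};p_\varepsilon)=\mathbb{E}_{\varepsilon\sim p_\varepsilon}\left[1-h(\breve{x}+\varepsilon)\right].$$ The soft recourse invalidation rate is $\Theta(\breve{x};p_\varepsilon)=\mathbb{E}_{\varepsilon\sim p_\varepsilon}\left[1-f(\breve{x}+\varepsilon)\right]$, and its Monte-Carlo estimator from $K$ random samples $\varepsilon_1,\dots,\varepsilon_K$ of $p_\varepsilon$ is $$\tilde{\Theta}(\breve{x};K,p_\varepsilon)=\frac{1}{K}\sum_{k=1}^{K}\left(1-f(\breve{x}+\varepsilon_k)\right).$$ *)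

(* Defs.v *)
From HB Require Import structures.
From mathcomp Require Import all_boot all_order all_algebra.
From mathcomp Require Import all_classical all_reals all_analysis.
From mathcomp Require Import measurable_realfun.

Set Implicit Arguments.
Unset Strict Implicit.
Unset Printing Implicit Defensive.

Import Order.TTheory GRing.Theory Num.Theory.
Import numFieldNormedType.Exports.

Local Open Scope classical_set_scope.
Local Open Scope ring_scope.

(* A function on a set [X] of R^n is represented by a total function on R^n;
   nothing is assumed about its values outside [X]. *)

(* R^n with its Borel sigma-algebra. *)
Notation borel_rV R n := (g_sigma_algebraType (@open 'rV[R]_n)).

(* Differentiability relative to [X]: only increments that stay in [X] matter.
   For [X u] the limit of [within X (nbhs u)] is [u], so that this reads
   f y = f u + L (y - u) + o(y - u) as y tends to u in X, with L linear and
   continuous.  For open [X] it is ordinary differentiability at each u in X. *)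
Definition differentiable_on (R : realType) (n : nat) (X : set 'rV[R]_n)
    (f : 'rV[R]_n -> R) : Prop :=
  forall u, X u -> differentiable f (within X (nbhs u)).

(* [true] is class 1 and [false] is class 0. *)
Definition classifier (R : realType) (n : nat) (f : 'rV[R]_n -> R) (t : R)
    (u : 'rV[R]_n) : bool := t < f u.

Definition counterfactual (R : realType) (n : nat) (X : set 'rV[R]_n)
    (h : 'rV[R]_n -> bool) (x xc : 'rV[R]_n) : Prop :=
  X xc /\ h xc <> h x.

Definition invalidation_rate (R : realType) (n : nat) (h : 'rV[R]_n -> bool)
    (xc : 'rV[R]_n) (p : probability (borel_rV R n) R) : \bar R :=
  'E_p[fun e : 'rV[R]_n => (1 - (h (xc + e))%:R)%R]%E.

Definition soft_invalidation_estimator (R : realType) (n K : nat)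
    (f : 'rV[R]_n -> R) (xc : 'rV[R]_n) (e : 'I_K -> 'rV[R]_n) : R :=
  K%:R^-1 * \sum_(k < K) (1 - f (xc + e k)).

Definition mutually_independent (d d' : measure_display) (T : measurableType d)
    (T' : measurableType d') (R : realType) (P : probability T R)
    (I : finType) (Y : I -> {RV P >-> T'}) : Prop :=
  forall (J : {set I}) (A : I -> set T'),
    (forall i, i \in J -> measurable (A i)) ->
    P (\bigcap_(i in [set` J]) (Y i @^-1` A i)) =
    (\prod_(i in J) P (Y i @^-1` A i))%E.

(* Equality of laws is tested on measurable sets only: a [probability] is a
   function on all sets, and carries no information on the other ones. *)
Definition has_distribution (d d' : measure_display) (T : measurableType d)
    (T' : measurableType d') (R : realType) (P : probability T R)
    (Y : {RV P >-> T'}) (p : probability T' R) : Prop :=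
  forall A : set T', measurable A -> distribution P Y A = p A.

(* [E] is an event of the completion of [P], of completed probability at least
   [a].  Since [X] need not be Borel, an event that involves the values of a
   function on [X] at random points that are only almost surely in [X] is in
   general measurable only up to a negligible set.  The outer measure of [P]
   agrees with [P] on measurable sets, and is the completion of [P] on the
   completed sigma-algebra. *)
Definition completed_prob_ge (d : measure_display) (T : measurableType d) (R : realType)
    (P : probability T R) (E : set T) (a : R) : Prop :=
  completed_algebra_gen P E /\ (a%:E <= (P^*)%mu E)%E.

(* Main.v *)
Require Import Defs.
From HB Require Import structures.
From mathcomp Require Import all_boot all_order all_algebra.
From mathcomp Require Import all_classical all_reals all_analysis.
From mathcomp Require Import measurable_realfun.
From mathcomp Require Import ring lra.

(* If f u > t the class-0 indicator at u vanishes, and otherwise 1 - f u >= 1 - t;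
   hence 1 - h <= (1 - f) / (1 - t) pointwise, and the invalidation rate is at
   most mu / (1 - t) with mu the soft rate.  Hoeffding's inequality bounds by
   exp (-2 m^2 K) the probability that the empirical mean of 1 - f falls below
   mu by m or more.  Since f need only be defined on X, 1 - f is replaced by a
   Borel function that agrees with it off a null set: differentiability makes f
   continuous relative to X, hence Borel on any Borel subset of X. *)

Set Implicit Arguments.
Unset Strict Implicit.
Unset Printing Implicit Defensive.

Import Order.TTheory GRing.Theory Num.Theory.
Import numFieldNormedType.Exports.

Local Open Scope classical_set_scope.
Local Open Scope ring_scope.

(** * Relative differentiability and Borel measurability *)

Lemma differentiable_within_cvg (R : realType) (V W : normedModType R) (X : set V)
    (f : V -> W) (u : V) :
  X u -> differentiable f (within X (nbhs u)) -> f @ within X (nbhs u) --> f u.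
Proof.
move=> Xu /diffP[dc].
(* Differentiability along a filter expands [f] at the limit of that filter. This limit is [u],
   because [X u] makes the filter proper and normed spaces are Hausdorff. *)
have PF : ProperFilter (within X (nbhs u)).
  exact: within_nbhs_proper (subset_closure Xu).
have -> : lim (within_filter_on X (nbhs_filter_on u)) = u.
  by apply: (@cvg_lim V _ _ (within X (nbhs u)) PF id u);
    [exact: norm_hausdorff|exact: cvg_within].
move: dc; set D := (X in continuous X) => dc h.
have D0 : D 0 = 0 by exact: linear0.
suff fD : f x - (f u + D (x - u)) @[x --> within X (nbhs u)] --> (0 : W).
  have Dc : f u + D (x - u) @[x --> within X (nbhs u)] --> f u.
    apply: cvg_within_filter.
    suff : f u + D (x - u) @[x --> u] --> f u + D (u - u).
      by rewrite subrr D0 addr0.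
    apply: cvgD; first exact: cvg_cst.
    apply: (@continuous_comp _ _ _ (fun x => x - u) D u); last exact: dc.
    by apply: cvgB; [exact: cvg_id|exact: cvg_cst].
  have fE : (fun x => f u + D (x - u) + (f x - (f u + D (x - u)))) = f.
    by apply/funext => x; rewrite addrC subrK.
  by have := cvgD Dc fD; rewrite addr0 => c; rewrite -{1}fE; exact: c.
have cu : x - u @[x --> within X (nbhs u)] --> (0 : V).
  apply: cvg_within_filter.
  suff : x - u @[x --> u] --> u - u by rewrite subrr.
  by apply: cvgB; [exact: cvg_id|exact: cvg_cst].
apply/cvgr0Pnorm_le => e e0.
have /cvgr0Pnorm_le/(_ e e0) xe := cu.
(* The little-o estimate with constant 1 bounds the remainder by the norm of [x - u], which tends to
   0. *)
have oP := (eqaddoP (within_filter_on X (nbhs_filter_on u)) f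
  (fun x => f u + D (x - u)) (+%R^~ (- u))).1 (funext h) 1 ltr01.
apply: filterS2 xe oP => x {}xe.
by rewrite mul1r => /le_trans; apply.
Qed.

Lemma differentiable_within_gt (R : realType) (V : normedModType R) (X : set V)
    (f : V -> R) (v e : V) (y : R) :
  X (v + e) -> differentiable f (within X (nbhs (v + e))) -> y < f (v + e) ->
  \forall e' \near e, X (v + e') -> y < f (v + e').
Proof.
move=> Xve /(differentiable_within_cvg Xve)/cvgr_gt/(_ y) h /h.
rewrite near_withinE => {}h.
suff cv : (v + x) @[x --> e] --> v + e by exact: (cv _ h).
by apply: cvgD; [exact: cvg_cst|exact: cvg_id].
Qed.

(** Open rays generate the Borel sets of the line, and the preimage of a ray is the trace on [D] of
    [U], the interior of the set of [e] for which [X (v + e)] implies the inequality. Putting [X] in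
    the premise makes [U] open in the whole space even when [X] is not Borel. *)
Lemma differentiable_on_measurable (R : realType) (n : nat) (X : set 'rV[R]_n)
    (f : 'rV[R]_n -> R) (v : 'rV[R]_n) (D : set (borel_rV R n)) :
  differentiable_on X f -> (forall e, D e -> X (v + e)) ->
  measurable_fun D (fun e : borel_rV R n => f (v + e)).
Proof.
move=> df DX mD.
apply: (measurability _ (RGenOInfty.measurableE R)) => //.
move=> _ [_ [y ->] <-].
pose U := [set e : 'rV[R]_n | \forall e' \near e, X (v + e') -> y < f (v + e')].
have -> : D `&` (fun e => f (v + e)) @^-1` `]y, +oo[ = D `&` U.
  apply/seteqP; split => e /= [De]; rewrite in_itv/= andbT.
  - move=> ye; split => //; have Xe := DX e De.
    exact: (differentiable_within_gt Xe (df _ Xe) ye).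
  - by move=> /nbhs_singleton h; split => //; apply: h; exact: DX.
apply: measurableI => //.
apply: sub_sigma_algebra.
exact: (open_interior [set e : 'rV[R]_n | X (v + e) -> y < f (v + e)]).
Qed.

(** * The moment generating function of a Bernoulli variable *)

Lemma is_derive_ge0_le (R : realType) (f f' : R -> R) (s : R) :
  (forall x : R, is_derive x 1 f (f' x)) -> (forall x, 0 <= x -> 0 <= f' x) ->
  0 <= s -> f 0 <= f s.
Proof.
move=> df f'0 s0; apply: (@ger0_derive1_le_cc R f 0 s) => //.
- move=> x; rewrite in_itv/= => /andP[x0 _]; have [_ d] := df x.
  by rewrite derive1E d; apply: f'0; exact: ltW.
- apply: continuous_subspaceT => x; apply: differentiable_continuous.
  by apply/derivable1_diffP; have [] := df x.
- by rewrite in_itv/= lexx.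
- by rewrite in_itv/= lexx andbT.
Qed.

(* The logarithm of the quotient of the two sides vanishes to first order at
   s = 0, and its second derivative is 1/4 - r (1 - r) = (r - 1/2)^2. *)
Lemma bernoulli_mgf_le (R : realType) (p s : R) : 0 <= p <= 1 -> 0 <= s ->
  1 - p + p * expR (- s) <= expR (s ^+ 2 / 8 - s * p).
Proof.
move=> /andP[p0 p1] s0.
(* [q] is the Laplace transform of a Bernoulli variable, [psi] is the derivative of [L], and
   [p * expR (- x) / q x] is the success probability under exponential tilting. *)
pose q (x : R) : R := 1 - p + p * expR (- x).
have q0 (x : R) : 0 < q x.
  rewrite /q; have [->|pn0] := eqVneq p 0; first by rewrite mul0r addr0 subr0.
  apply: ltr_wpDl; first by rewrite subr_ge0.
  by rewrite mulr_gt0 ?expR_gt0// lt0r pn0.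
have dq (x : R) : is_derive x 1 q (- (p * expR (- x))).
  rewrite /q; apply: is_derive_eq.
  by rewrite /GRing.scale /=; lra.
pose psi (x : R) : R := x / 4 - p + p * expR (-x) / q x.
have dpsi (x : R) : is_derive x 1 psi
    (1/4 - p * expR (-x) / q x * (1 - p * expR (-x) / q x)).
  have h := @is_deriveV _ q x _ 1 (lt0r_neq0 (q0 x)) (dq x).
  rewrite /psi; apply: is_derive_eq.
  rewrite /GRing.scale /=.
  by field; rewrite lt0r_neq0.
pose L (x : R) : R := x ^+ 2 / 8 - x * p - ln (q x).
have dL (x : R) : is_derive x 1 L (psi x).
  have h := @is_derive1_comp _ _ q x _ _ (is_derive1_ln (q0 x)) (dq x).
  rewrite /L; apply: is_derive_eq.
  rewrite /GRing.scale /=.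
  by rewrite /psi; field; rewrite lt0r_neq0.
have psi0 (x : R) : 0 <= x -> 0 <= psi x.
  move=> x0; have -> : 0 = psi 0 :> R.
    by rewrite /psi /q oppr0 expR0 mulr1 subrK divr1 mul0r sub0r addNr.
  apply: (is_derive_ge0_le dpsi) => // y _.
  set r := _ / q _; have : 0 <= (r - 1/2) ^+ 2 by exact: sqr_ge0.
  by rewrite !expr2; lra.
have L0 : 0 <= L s.
  have -> : 0 = L 0 :> R.
    by rewrite /L /q oppr0 expR0 mulr1 subrK ln1 expr0n /= !mul0r !subr0.
  exact: is_derive_ge0_le dL psi0 s0.
rewrite -[leLHS]lnK ?posrE ?q0// ler_expR.
by move: L0; rewrite /L /q subr_ge0.
Qed.

(** * Expectation of a product of independent variables *)

Import HBNNSimple.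

Section weighted_change_of_variables.
Context d d' (T : measurableType d) (T' : measurableType d') (R : realType).
Variables (P : {measure set T -> \bar R}) (q : {measure set T' -> \bar R}).
Variables (Y : T -> T') (W : T -> R) (c : R).
Hypotheses (mY : measurable_fun setT Y) (mW : measurable_fun setT W).
Hypotheses (W0 : forall w, 0 <= W w) (c0 : 0 <= c).
Hypothesis WY : forall A, measurable A ->
  (\int[P]_w (W w * \1_A (Y w))%:E = c%:E * q A)%E.

Let weighted_nnsfun (h : {nnsfun T' >-> R}) :
  (\int[P]_w (W w * h (Y w))%:E = c%:E * \int[q]_y (h y)%:E)%E.
Proof.
have mhr r : measurable (h @^-1` [set r]) by exact: measurable_funPTI.
have mind r : measurable_fun setT (fun w => W w * \1_(h @^-1` [set r]) (Y w)).
  by apply: measurable_funM => //; apply: measurableT_comp => //;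
    exact: measurable_indic.
rewrite [X in (_ * X)%E](_ : _ =
    \sum_(r \in range h) (r%:E * q (h @^-1` [set r])))%E; last first.
  by rewrite integralT_nnsfun sintegralE.
rewrite ge0_mule_fsumr; last exact: nnsfun_mulemu_ge0.
transitivity (\int[P]_w (\sum_(r \in range h)
    (r%:E * (W w * \1_(h @^-1` [set r]) (Y w))%:E)))%E.
  apply: eq_integral => w _; rewrite {1}(fimfunE h) EFinM -fsumEFin// ge0_mule_fsumr.
    by apply: eq_fsbigr => r _; rewrite !EFinM muleCA.
  by move=> r; exact: nnfun_muleindic_ge0.
rewrite ge0_integral_fsum//.
- apply: eq_fsbigr => r; rewrite inE => -[y _ <-].
  rewrite ge0_integralZl_EFin// ?WY//; first by rewrite muleCA.
  + by move=> w _; rewrite lee_fin mulr_ge0.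
  + exact/measurable_EFinP.
- by move=> r; apply/measurable_EFinP; exact: measurable_funM.
(* Nonnegativity is required for every real [r]; for negative [r] the fibre of [h] is empty. *)
- move=> r w _; have [r0|r0] := leP 0 r.
    by rewrite mule_ge0 // lee_fin mulr_ge0.
  by rewrite preimage_nnfun0// indic0 mulr0 mule0.
Qed.

(** [WY] says that the measure with density [W] relative to [P] has image [c] times [q] under [Y].
    Approximation by simple functions and monotone convergence carry this from sets to functions. It
    serves to separate one factor of a product: [W] is then the product of the other factors and [c]
    the product of their integrals. *)
Lemma weighted_ge0_integral (phi : T' -> R) : measurable_fun setT phi ->
  (forall y, 0 <= phi y) ->
  (\int[P]_w (W w * phi (Y w))%:E = c%:E * \int[q]_y (phi y)%:E)%E.
Proof.
move=> mphi phi0.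
have mphi' : measurable_fun setT (EFin \o phi) by exact/measurable_EFinP.
pose h := nnsfun_approx measurableT mphi'.
have hphi y : (EFin \o h ^~ y) @ \oo --> (phi y)%:E.
  by apply: (cvg_nnsfun_approx measurableT mphi') => // z _; rewrite lee_fin.
have ndh y : nondecreasing_seq (h ^~ y).
  by move=> i j ij; have /lefP := nd_nnsfun_approx measurableT mphi' ij.
transitivity (limn (fun n => \int[P]_w (W w * h n (Y w))%:E)%E).
  rewrite -monotone_convergence//.
  - apply: eq_integral => w _; apply/esym/cvg_lim => //.
    under eq_fun do rewrite EFinM.
    by rewrite EFinM; apply: cvgeZl => //; exact: hphi.
  - move=> n; apply/measurable_EFinP/measurable_funM => //.
    exact: measurableT_comp.
  - by move=> n w _; rewrite lee_fin mulr_ge0.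
  - by move=> w _ i j ij; rewrite lee_fin ler_wpM2l//; exact: ndh.
under eq_fun do rewrite weighted_nnsfun.
have : (\int[q]_y (h n y)%:E)%E @[n --> \oo] --> (\int[q]_y (phi y)%:E)%E.
  have := @cvg_monotone_convergence _ _ _ q setT measurableT
    (fun n y => (h n y)%:E).
  rewrite (_ : (fun x => limn ((fun n y => (h n y)%:E)^~ x)) = EFin \o phi);
    last first.
    by apply/funext => y /=; have /cvg_lim := hphi y; apply.
  apply.
  - by move=> n; exact/measurable_EFinP.
  - by move=> n y _; rewrite lee_fin.
  - by move=> y _ i j ij; rewrite lee_fin ndh.
by move=> H; apply/cvg_lim => //; exact: cvgeZl.
Qed.

End weighted_change_of_variables.

Lemma prod_indic (T : Type) (R : comPzRingType) (I : finType) (A : I -> set T) (w : T) :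
  \prod_(i : I) \1_(A i) w = \1_(\bigcap_i A i) w :> R.
Proof.
rewrite indicE; have [/set_mem Aw|/negP nAw] := boolP (w \in _).
  by rewrite big1// => i _; rewrite indicE mem_set//; exact: Aw.
have [i nAi] : exists i, ~ A i w.
  by apply/existsNP => Aw; apply: nAw; apply/mem_set => i _; exact: Aw.
by rewrite (bigD1 i)//= indicE memNset// mul0r.
Qed.

Lemma independent_integral_prod d d' (T : measurableType d)
    (T' : measurableType d') (R : realType) (P : probability T R)
    (q : probability T' R) (I : finType) (Y : I -> {RV P >-> T'})
    (F : I -> T' -> R) :
  mutually_independent Y -> (forall i, has_distribution (Y i) q) ->
  (forall i, measurable_fun setT (F i)) -> (forall i y, 0 <= F i y) ->
  (forall i, (\int[q]_y (F i y)%:E)%E \is a fin_num) ->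
  (\int[P]_w (\prod_i F i (Y i w))%:E = \prod_i \int[q]_y (F i y)%:E)%E.
Proof.
move=> indY distY.
(* The product rule for events is the case where every [F i] is an indicator;
   the indicators are replaced one index at a time by arbitrary functions. *)
suff H (r : seq I) : forall F : I -> T' -> R,
    (forall i, measurable_fun setT (F i)) -> (forall i y, 0 <= F i y) ->
    (forall i, (\int[q]_y (F i y)%:E)%E \is a fin_num) ->
    (forall i, i \notin r -> exists2 A, measurable A & F i = \1_A) ->
    (\int[P]_w (\prod_i F i (Y i w))%:E = \prod_i \int[q]_y (F i y)%:E)%E.
  move=> mF F0 Ffin; apply: (H (enum I)) => // i.
  by rewrite mem_enum.
elim: r => [|i r IH] {}F mF F0 Ffin Fr.
  have /choice[A AP] : forall i, exists A, measurable A /\ F i = \1_A.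
    by move=> i; have [//|A mA FA] := Fr i; exists A.
  have mYA j : measurable (Y j @^-1` A j).
    by apply: measurable_funPTI => //; apply: (AP j).1.
  have := indY [set: I]%SET A (fun i _ => (AP i).1).
  rewrite (_ : [set` [set: I]%SET] = [set: I]); last first.
    by apply/seteqP; split => // j _ /=; rewrite finset.in_setT.
  under eq_bigl do rewrite finset.in_setT.
  move=> indA; transitivity (P (\bigcap_i (Y i @^-1` A i))).
    rewrite -[in RHS](setIT (\bigcap_i _)) -integral_indic//; last first.
      by apply: fin_bigcap_measurable.
    apply: eq_integral => w _; congr _%:E; rewrite -prod_indic.
    by apply: eq_bigr => j _; rewrite (AP j).2.
  rewrite indA; apply: eq_bigr => j _.
  rewrite (AP j).2 integral_indic// ?setIT; last exact: (AP j).1.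
  exact: (distY j _ (AP j).1).
have mprod (J : pred I) (G : I -> T' -> R) : (forall j, measurable_fun setT (G j)) ->
    measurable_fun setT (fun w => \prod_(j | J j) G j (Y j w)).
  move=> mG; under eq_fun do rewrite big_mkcond.
  apply: measurable_prod => j _; case: (J j) => //.
  exact: measurableT_comp.
under eq_integral do rewrite (bigD1 i)//= mulrC.
rewrite (bigD1 i)//= muleC.
(* Finiteness lets the product of the other integrals serve as the real constant [c]. *)
have cfin : (\prod_(j | j != i) \int[q]_y (F j y)%:E)%E \is a fin_num.
  by apply: prode_fin_num => j _.
rewrite -(fineK cfin).
apply: (@weighted_ge0_integral _ _ _ _ _ P q (Y i)
  (fun w => \prod_(j | j != i) F j (Y j w))) => //.
- exact: mprod.
- by move=> w; exact: prodr_ge0.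
(* Hypothesis [WY] is the induction hypothesis for [G], which is [F] with entry [i] replaced by
   [\1_A]: only the indices in [r] are then left arbitrary. *)
- move=> A mA; rewrite fineK//.
  pose G j := if j == i then \1_A else F j.
  have GF j : j != i -> G j = F j by rewrite /G => /negbTE ->.
  have Gi : G i = \1_A by rewrite /G eqxx.
  have mG j : measurable_fun setT (G j).
    by have [->|/GF->//] := eqVneq j i; rewrite Gi; exact: measurable_indic.
  have G0 j y : 0 <= G j y.
    by have [->|/GF->//] := eqVneq j i; rewrite Gi indicE.
  have Gfin j : (\int[q]_y (G j y)%:E)%E \is a fin_num.
    have [->|/GF->//] := eqVneq j i.
    by rewrite Gi integral_indic// fin_num_measure// setIT.
  have Gr j : j \notin r -> exists2 A, measurable A & G j = \1_A.
    move=> jr; have [->|ji] := eqVneq j i; first by exists A.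
    by rewrite GF//; apply: Fr; rewrite inE negb_or ji.
  transitivity (\int[P]_w (\prod_j G j (Y j w))%:E)%E.
    apply: eq_integral => w _; rewrite [in RHS](bigD1 i)//= Gi mulrC.
    by congr ((_ * _)%:E); apply: eq_bigr => j /GF->.
  rewrite IH// [LHS](bigD1 i)//= Gi integral_indic// setIT muleC.
  by congr (_ * _)%E; apply: eq_bigr => j /GF->.
Qed.

(** * Hoeffding's inequality *)

(** Convexity of the exponential between [- s] and 0. The bound is affine in [z], so its integral
    depends only on a mean. *)
Lemma expRN_chord (R : realType) (s z : R) : 0 <= z <= 1 ->
  expR (- (s * z)) <= 1 - z + z * expR (- s).
Proof.
move=> /andP[z0 z1].
have := @convex_expR R (Itv01 z0 z1) (-s) 0.
by rewrite !convRE/= expR0 mulr0 addr0 mulr1 mulrN mulrC addrC.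
Qed.

(** By the chord bound, the Bernoulli law is extremal among laws on [0, 1] with mean [mu], and
    [bernoulli_mgf_le] treats that case. *)
Lemma hoeffding_mgf d (T : measurableType d) (R : realType) (q : probability T R)
    (Z : T -> R) (mu s : R) :
  measurable_fun setT Z -> (forall y, 0 <= Z y <= 1) ->
  (\int[q]_y (Z y)%:E = mu%:E)%E -> 0 <= s ->
  (\int[q]_y (expR (s * (mu - Z y)))%:E <= (expR (s ^+ 2 / 8))%:E)%E.
Proof.
move=> mZ Z01 Zmu s0.
have intZ : q.-integrable setT (EFin \o Z).
  apply: measurable_bounded_integrable => //; first exact: fin_num_fun_lty.
  exists 1; split => // M M1 y _ /=.
  have /andP[Z0 Z1] := Z01 y.
  by rewrite ger0_norm// (le_trans Z1) ?ltW.
have mu01 : 0 <= mu <= 1.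
  rewrite -!lee_fin -Zmu; apply/andP; split.
    by apply: integral_ge0 => y _; rewrite lee_fin; case/andP: (Z01 y).
  have <- : (\int[q]_y (cst 1 y) = 1)%E.
    by rewrite integral_cst// mul1e; exact: probability_setT.
  apply: ge0_le_integral => //.
  - by move=> y _; rewrite lee_fin; case/andP: (Z01 y).
  - exact/measurable_EFinP.
  - by move=> y _; rewrite lee_fin; case/andP: (Z01 y).
apply: (@le_trans _ _ (\int[q]_y
    (expR (s * mu) + (expR (s * mu) * (expR (- s) - 1)) * Z y)%:E)%E).
  apply: ge0_le_integral => //.
  - apply/measurable_EFinP; apply: measurableT_comp => //.
    apply: measurable_funM => //; exact: measurable_funB.
  - apply/measurable_EFinP; apply: measurable_funD => //.
    exact: measurable_funM.
  - move=> y _; rewrite lee_fin mulrBr expRD.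
    rewrite (le_trans (ler_wpM2l (expR_ge0 _) (expRN_chord s (Z01 y))))//.
    by rewrite le_eqVlt; apply/orP; left; apply/eqP; ring.
under eq_integral do rewrite EFinD EFinM.
rewrite integralD//; last 2 first.
  - exact: finite_measure_integrable_cst.
  - exact: integrableZl.
rewrite integralZl// Zmu integral_cst//.
rewrite [X in (_ * X + _)%E](_ : _ = 1%E); last exact: probability_setT.
rewrite mule1 -EFinM -EFinD lee_fin.
apply: (@le_trans _ _ (expR (s * mu) * expR (s ^+ 2 / 8 - s * mu))); last first.
  by rewrite -expRD addrC subrK.
rewrite (le_trans _ (ler_wpM2l (expR_ge0 _) (bernoulli_mgf_le mu01 s0)))//.
by rewrite le_eqVlt; apply/orP; left; apply/eqP; ring.
Qed.

(** Chernoff's method: independence factors the exponential moment of the sum, and each factor is at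
    most [expR (2 * m ^+ 2)]. *)
Lemma hoeffding d d' (T : measurableType d) (T' : measurableType d') (R : realType)
    (P : probability T R) (q : probability T' R) (I : finType)
    (Y : I -> {RV P >-> T'}) (Z : T' -> R) (mu m : R) :
  mutually_independent Y -> (forall i, has_distribution (Y i) q) ->
  measurable_fun setT Z -> (forall y, 0 <= Z y <= 1) ->
  (\int[q]_y (Z y)%:E = mu%:E)%E -> 0 <= m ->
  (P [set w | (m *+ #|I| <= \sum_i (mu - Z (Y i w)))%R] <=
    (expR (- (2 * m ^+ 2 * #|I|%:R)))%:E)%E.
Proof.
move=> indY distY mZ Z01 Zmu m0.
set S := [set w | _].
have mZY i : measurable_fun setT (fun w => mu - Z (Y i w)).
  by apply: measurable_funB => //; exact: measurableT_comp.
have mS : measurable S.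
  by rewrite -[S]setTI; apply: measurable_fun_le => //; exact: measurable_sum.
(* [4 * m] minimizes [s ^+ 2 / 8 - s * m], the exponent of the Chernoff bound. *)
pose F y := expR (4 * m * (mu - Z y)).
have mF : measurable_fun setT F.
  apply: measurableT_comp => //; apply: measurable_funM => //.
  exact: measurable_funB.
have F0 y : 0 <= F y by exact: expR_ge0.
have Fle : (\int[q]_y (F y)%:E <= (expR (2 * m ^+ 2))%:E)%E.
  have -> : 2 * m ^+ 2 = (4 * m) ^+ 2 / 8 by field.
  by apply: hoeffding_mgf => //; rewrite mulr_ge0.
have Fge : (0 <= \int[q]_y (F y)%:E)%E.
  by apply: integral_ge0 => y _; rewrite lee_fin.
have Ffin : (\int[q]_y (F y)%:E)%E \is a fin_num.
  by rewrite ge0_fin_numE// (le_lt_trans Fle)// ltry.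
(* Markov's inequality, done by hand: on [S] the product of the [F (Y i w)] is at least the constant
   multiplied in here. *)
rewrite -(@lee_pmul2l _ (expR (4 * m ^+ 2 * #|I|%:R))%:E)//; last first.
  by rewrite lte_fin expR_gt0.
rewrite -EFinM -expRD.
apply: (@le_trans _ _ (\int[P]_w (\prod_(i : I) F (Y i w))%:E)%E).
  rewrite -[S]setIT -integral_indic// -ge0_integralZl_EFin//.
  apply: ge0_le_integral => //.
  - by apply/measurable_EFinP/measurable_funM => //; exact: measurable_indic.
  - apply/measurable_EFinP; apply: measurable_prod => i _.
    exact: measurableT_comp.
  - move=> w _; rewrite -EFinM lee_fin indicE.
    have [/set_mem /= Sw|] := boolP (w \in S); last by rewrite mulr0 prodr_ge0.
    rewrite mulr1 /F -expR_sum ler_expR -mulr_sumr.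
    rewrite expr2 -!mulrA ler_wpM2l// ler_wpM2l//.
    by rewrite mulr_natr.
  - exact/measurable_EFinP/measurable_indic.
rewrite (independent_integral_prod (F := fun=> F) indY distY)//.
rewrite -(fineK Ffin) -(big_morph EFin (@EFinM R) erefl).
rewrite lee_fin prodr_const.
have -> : 4 * m ^+ 2 * #|I|%:R - 2 * m ^+ 2 * #|I|%:R =
  2 * m ^+ 2 * #|I|%:R by ring.
rewrite expRM_natr lerXn2r// ?nnegrE ?expR_ge0 ?fine_ge0//.
by rewrite -lee_fin fineK.
Qed.

(** * Nonmeasurable integrands and completed events *)

(* [ge0_le_integral] requires [u] and [v] to be measurable, which fails for the
   classifier: [f] is arbitrary off [X]. *)
Lemma le_integral_nonmeasurable d (T : measurableType d) (R : realType)
    (mu : {measure set T -> \bar R}) (u v : T -> \bar R) :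
  (forall y, 0 <= u y)%E -> (forall y, u y <= v y)%E ->
  (\int[mu]_y u y <= \int[mu]_y v y)%E.
Proof.
move=> u0 uv; have v0 y : (0 <= v y)%E by exact: le_trans (uv y).
rewrite !ge0_integralTE//; apply: le_ereal_sup => _ [h /= hu <-].
by exists h => //= y; exact: le_trans (uv y).
Qed.

(** [E] is the measurable set [E' \ B] together with a subset of the null set [B], and removing [B]
    from [E'] does not lower its probability. *)
Lemma completed_prob_ge_ae d (T : measurableType d) (R : realType)
    (P : probability T R) (E E' B : set T) (a : R) :
  measurable E' -> measurable B -> P B = 0%E -> E `\` B = E' `\` B ->
  (a%:E <= P E')%E -> completed_prob_ge P E a.
Proof.
move=> mE' mB PB EE' aE'.
have mE'B : measurable (E' `\` B) by exact: measurableD.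
split.
  exists (E' `\` B) => //; exists (E `&` B).
    by exists B; split => //; exact: subIsetr.
  by rewrite -EE' setUC setUIDK.
apply: (le_trans aE').
rewrite (@le_trans _ _ (P^*%mu (E' `\` B)))//; last first.
  by apply: le_outer_measure; rewrite -EE'; exact: subDsetl.
rewrite measurable_mu_extE// -(measureU0 mE'B mB PB).
apply: le_measure; rewrite ?inE//; first exact: measurableU.
by move=> w E'w; have [Bw|nBw] := pselect (B w); [right|left].
Qed.

(** * The bound on the invalidation rate *)

Lemma classifier_error_le (R : realFieldType) (y t : R) : y <= 1 -> t < 1 ->
  1 - (t < y)%R%:R <= (1 - y) / (1 - t).
Proof.
move=> y1 t1; have t1' : 0 < 1 - t by rewrite subr_gt0.
rewrite ler_pdivlMr//; case: ltP => [_|yt].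
  by rewrite subrr mul0r subr_ge0.
by rewrite subr0 mul1r lerB.
Qed.

Theorem proposition2 (R : realType) (n : nat) (X : set 'rV[R]_n)
    (f : 'rV[R]_n -> R) (t : R) (x xc : 'rV[R]_n)
    (p : probability (borel_rV R n) R)
    (d : measure_display) (Omega : measurableType d) (P : probability Omega R)
    (K : nat) (eps : 'I_K -> {RV P >-> borel_rV R n}) (m : R)
    (f01 : forall u, X u -> 0 <= f u <= 1)
    (f_diff : differentiable_on X f)
    (t01 : 0 <= t < 1)
    (Xx : X x)
    (hx : classifier f t x = false)
    (xc_cf : counterfactual X (classifier f t) x xc)
    (noise_in_X : {ae p, forall e : 'rV[R]_n, X (xc + e)})
    (K_ge1 : (1 <= K)%N)
    (eps_dist : forall k, has_distribution (eps k) p)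
    (eps_indep : mutually_independent eps)
    (m_gt0 : 0 < m) :
  completed_prob_ge P
    [set w | (invalidation_rate (classifier f t) xc p <=
              ((m + soft_invalidation_estimator f xc (fun k => eps k w))
                 / (1 - t))%:E)%E]
    (1 - expR (- (2 * m ^+ 2 * K%:R))).
Proof.
have [N [mN pN XN]] := noise_in_X.
have {}XN e : ~ N e -> X (xc + e) by move=> nNe; apply: contrapT => /XN.
(* The restriction is [point = 0] on [N], so that [1 - g] is at its largest there
   and dominates the class-0 indicator on all of R^n. *)
pose g : borel_rV R n -> R := (fun e => f (xc + e)) \_ (~` N).
have mg : measurable_fun setT g.
  have := @differentiable_on_measurable R n X f xc (~` N) f_diff XN.
  exact: (measurable_restrictT _ (measurableC mN)).1.
have g01 e : 0 <= g e <= 1.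
  rewrite /g patchE; case: ifPn => [/set_mem/XN/f01//|_].
  by rewrite lexx ler01.
have gE e : ~ N e -> g e = f (xc + e).
  by move=> nNe; rewrite /g patchE mem_set.
pose Z e := 1 - g e.
have mZ : measurable_fun setT Z by exact: measurable_funB.
have Z01 e : 0 <= Z e <= 1.
  by rewrite subr_ge0 lerBlDr lerDl andbC; exact: g01.
have Z0 e : 0 <= Z e by case/andP: (Z01 e).
have /fineK : (\int[p]_e (Z e)%:E)%E \is a fin_num.
  rewrite ge0_fin_numE; last by apply: integral_ge0 => e _; rewrite lee_fin.
  apply: (@le_lt_trans _ _ (\int[p]_e (cst 1 e))%E).
    apply: le_integral_nonmeasurable => e; first by rewrite lee_fin.
    by rewrite lee_fin; case/andP: (Z01 e).
  by rewrite integral_cst// mul1e (le_lt_trans (probability_le1 _ _))// ltry.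
set mu := fine _ => /esym Zmu.
have [t0 t1] := andP t01.
have Gle : (invalidation_rate (classifier f t) xc p <= (mu / (1 - t))%:E)%E.
  rewrite /invalidation_rate unlock.
  have -> : (mu / (1 - t))%:E = (\int[p]_e (Z e / (1 - t))%:E)%E.
    under eq_integral do rewrite mulrC EFinM.
    rewrite ge0_integralZl_EFin//.
    - by rewrite Zmu -EFinM mulrC.
    - by move=> e _; rewrite lee_fin.
    - exact/measurable_EFinP.
    - by rewrite invr_ge0 subr_ge0 ltW.
  apply: le_integral_nonmeasurable => e; rewrite lee_fin.
    by case: classifier; rewrite ?subrr ?subr0.
  rewrite /Z; have /andP[g0 g1] := g01 e.
  have [Ne|nNe] := pselect (N e); last first.
    by rewrite /classifier -(gE e nNe); apply: classifier_error_le.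
  rewrite /g patchE memNset; last by case.
  rewrite (_ : point = 0 :> R)//.
  (* The value 0 falls in class 0 because [0 <= t], so this instance says that [1 / (1 - t)] is at
     least 1, hence at least any indicator. *)
  have := classifier_error_le ler01 t1; rewrite ltNge t0 /= => le1.
  by apply: le_trans le1; rewrite lerB.
have Gge : (0 <= invalidation_rate (classifier f t) xc p)%E.
  rewrite /invalidation_rate unlock; apply: integral_ge0 => e _.
  by rewrite lee_fin; case: classifier; rewrite ?subrr ?subr0.
have /fineK : invalidation_rate (classifier f t) xc p \is a fin_num.
  by rewrite ge0_fin_numE// (le_lt_trans Gle)// ltry.
move: Gle; set Gam := invalidation_rate _ _ _; set gam := fine _ => Gle GamE.
move: Gle; rewrite -GamE lee_fin => gle.
(* [E'] is the target event with [Z] in place of [1 - f]. It is measurable, and it agrees with the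
   target off [B], the null event that some sample falls in [N]. *)
pose B := \bigcup_k (eps k @^-1` N).
pose E' := [set w | gam <= (m + K%:R^-1 * \sum_k Z (eps k w)) / (1 - t)].
have mBk k : measurable (eps k @^-1` N) by exact: measurable_funPTI.
have mB : measurable B by exact: fin_bigcup_measurable.
have PB : P B = 0%E.
  apply/eqP; rewrite eq_le measure_ge0 andbT.
  rewrite (le_trans (content_sub_fsum (D := setT)
    (A_ := fun k => eps k @^-1` N) P _ _ _ (@subset_refl _ B)))//.
    exact: finite_finset.
  by rewrite fsbig1// => k _; rewrite -pN -(eps_dist k).
have estE w : ~ B w -> K%:R^-1 * \sum_k Z (eps k w) =
    soft_invalidation_estimator f xc (fun k => eps k w).
  move=> nBw; congr (_ * _); apply: eq_bigr => k _.
  by rewrite /Z gE// => Nk; apply: nBw; exists k.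
have mE' : measurable E'.
  rewrite -[E']setTI; apply: measurable_fun_le => //.
  apply: measurable_funM => //; apply: measurable_funD => //.
  apply: measurable_funM => //; apply: measurable_sum => k.
  exact: measurableT_comp.
apply: (@completed_prob_ge_ae _ _ _ P _ E' B) => //.
- by apply/seteqP; split => w /= [Ew nBw]; split => //; move: Ew;
    rewrite lee_fin /E' /= (estE w nBw).
- have := hoeffding eps_indep eps_dist mZ Z01 Zmu (ltW m_gt0).
  rewrite card_ord; set S := [set w | _] => PS.
  have mS : measurable S.
    rewrite -[S]setTI; apply: measurable_fun_le => //; apply: measurable_sum => k.
    by apply: measurable_funB => //; exact: measurableT_comp.
  apply: (@le_trans _ _ (P (~` S))).
    by rewrite probability_setC// EFinB; exact: leeB.
  apply: le_measure; rewrite ?inE//; first exact: measurableC.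
  (* Off [S] the deviations sum to less than [m] times [K]; dividing by [K > 0] puts [mu] below [m]
     plus the empirical mean of [Z], and [gle] transfers this to [gam]. *)
  move=> w; rewrite /S /E' /= => /negP; rewrite -ltNge => Sw.
  apply: (le_trans gle); rewrite ler_pM2r ?invr_gt0 ?subr_gt0//.
  have K0 : 0 < K%:R :> R by rewrite ltr0n.
  rewrite -lerBlDr -(ler_pM2l K0) mulrBr mulVKf ?gt_eqF//.
  move: Sw; rewrite big_split/= sumrN sumr_const card_ord !mulr_natl.
  exact: ltW.
Qed.
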